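(* Let $\mathbb{K}$ be a field of characteristic zero and let $A$ be a commutative Noetherian $\mathbb{K}$-algebra. Suppose that either $A$ is finitely generated over $\mathbb{K}$, or that $A$ is complete. Let $f_1,\dots,f_\ell\in A$, let $\underline{s}=s_1,\dots,s_\ell$ be indeterminates, and let $M^A[\underline{f}^{\underline{s}}]=A_{f_1\cdots f_\ell}[\underline{s}]\,f_1^{s_1}\cdots f_\ell^{s_\ell}$ be the free rank-one $A_{f_1\cdots f_\ell}[\underline{s}]$-module on the formal symbol $f_1^{s_1}\cdots f_\ell^{s_\ell}$. Then there is a unique $D_{A|\mathbb{K}}[\underline{s}]$-module structure on $M^A[\underline{f}^{\underline{s}}]$ with the following property: for all $v\in M^A[\underline{f}^{\underline{s}}]$, all $\delta\in D_{A|\mathbb{K}}[\underline{s}]$ and all $t=(t_1,\dots,t_\ell)\in\mathbb{Z}^\ell$, $$\varphi_t(\delta\bullet v)=\delta(t)\bullet\varphi_t(v).$$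
   Context: For a commutative $\mathbb{K}$-algebra $T$, $D^0_T$ is the set of multiplications by elements of $T$, $D^m_T$ ($m\ge1$) is the set of additive maps $\delta:T\to T$ such that $[\delta,r]\in D^{m-1}_T$ for every $r\in T$, $D_T=\bigcup_m D^m_T$, and $D_{T|\mathbb{K}}\subseteq D_T$ is the subring of $\mathbb{K}$-linear differential operators. Modules over rings of differential operators are left modules; the action is denoted $\bullet$. For $g\in T$, each $\delta\in D_{T|\mathbb{K}}$ extends uniquely to an element of $D_{T_g|\mathbb{K}}$, and this makes $T_g$ a $D_{T|\mathbb{K}}$-module. $D_{A|\mathbb{K}}[\underline{s}]$ is the polynomial ring in (central) indeterminates $\underline{s}$ over $D_{A|\mathbb{K}}$; for $t\in\mathbb{Z}^\ell$, $\delta(t)\in D_{A|\mathbb{K}}$ is obtained from $\delta\in D_{A|\mathbb K}[\underline{s}]$ by substituting $s_i=t_i$. The exponent specialization map $\varphi_t:M^A[\underline{f}^{\underline{s}}]\to A_{f_1\cdots f_\ell}$ is the $A_{f_1\cdots f_\ell}$-linear map given by $\varphi_t\big(h(\underline{s})\,f_1^{s_1}\cdots f_\ell^{s_\ell}\big)=h(t)\,f_1^{t_1}\cdots f_\ell^{t_\ell}$. *)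

(* Defs.v *)
From HB Require Import structures.
From mathcomp Require Import all_boot all_order all_algebra finmap.
From mathcomp Require Import boolp classical_sets.
From mathcomp Require Import monalg.

Set Implicit Arguments.
Unset Strict Implicit.
Unset Printing Implicit Defensive.

Import GRing.Theory.
Local Open Scope ring_scope.
Local Open Scope classical_set_scope.

(* Neither A nor A_{f_1...f_l} is assumed to be nonzero: the product of the f_i
   may be nilpotent.  Rings are therefore (com)pzRingType, and a commutative
   K-algebra A is a ring morphism K -> A.  The library's ring structure on
   {malg R[M]} requires 1 != 0 in R, so the polynomial ring R[s_1, ..., s_n] in
   central indeterminates, over a possibly noncommutative and possibly zero ring
   R, is put on the additive group {malg R['X_{1..n}]}. *)
Definition polys (n : nat) (R : pzRingType) := {malg R['X_{1..n}]}.

HB.instance Definition _ n R := GRing.Zmodule.on (polys n R).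

Lemma associative_on_generators (V : zmodType) (mul : V -> V -> V)
    (gen : V -> Prop) :
  (forall P : V -> Prop, (forall p q, P p -> P q -> P (p + q)) -> P 0 ->
    (forall p, gen p -> P p) -> forall p, P p) ->
  left_distributive mul +%R -> right_distributive mul +%R ->
  left_zero 0 mul -> right_zero 0 mul ->
  (forall p q r, gen p -> gen q -> gen r -> mul p (mul q r) = mul (mul p q) r) ->
  associative mul.
Proof.
move=> ind mulDl mulDr mul0 mulr0 mulA p q r.
elim/ind: p => [p1 p2 IH1 IH2||p gp]; first by rewrite !mulDl IH1 IH2.
  by rewrite !mul0.
elim/ind: q => [p1 p2 IH1 IH2||q gq].
- by rewrite mulDl !mulDr mulDl IH1 IH2.
- by rewrite mul0 !mulr0 mul0.
elim/ind: r => [p1 p2 IH1 IH2||r gr]; first by rewrite !mulDr IH1 IH2.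
  by rewrite !mulr0.
exact: mulA.
Qed.

Section PolysRing.
Context (n : nat) (R : pzRingType).

Implicit Types (p q : polys n R) (m : 'X_{1..n}).

Definition polys1 : polys n R :=
  << (1 : R) *g (mone : 'X_{1..n}) >> : {malg R['X_{1..n}]}.

Definition polys_mul p q : polys n R :=
  \sum_(m1 <- msupp p) \sum_(m2 <- msupp q) << p@_m1 * q@_m2 *g (mmul m1 m2) >>.

Lemma polys_mulw (d1 d2 : {fset 'X_{1..n}}) p q :
  (msupp p `<=` d1)%fset -> (msupp q `<=` d2)%fset ->
  polys_mul p q =
    \sum_(m1 <- d1) \sum_(m2 <- d2) << p@_m1 * q@_m2 *g (mmul m1 m2) >>.
Proof.
move=> le_d1 le_d2; rewrite /polys_mul (big_fset_incl _ le_d1) /=.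
  apply/eq_bigr=> k1 _; apply/big_fset_incl => // k _ /mcoeff_outdom ->.
  by rewrite mulr0 monalgU0.
move=> k _ /mcoeff_outdom pk.
by rewrite big1 // => k' _; rewrite pk mul0r monalgU0.
Qed.

Lemma polys_mulDl : left_distributive polys_mul +%R.
Proof.
move=> p1 p2 q.
rewrite (polys_mulw (msuppD_le p1 p2) (fsubset_refl _)).
rewrite (polys_mulw (fsubsetUl _ (msupp p2)) (fsubset_refl _)).
rewrite (polys_mulw (fsubsetUr (msupp p1) _) (fsubset_refl _)).
rewrite -big_split /=; apply/eq_bigr=> k1 _.
rewrite -big_split /=; apply/eq_bigr=> k2 _.
by rewrite mcoeffD mulrDl monalgUD.
Qed.

Lemma polys_mulDr : right_distributive polys_mul +%R.
Proof.
move=> q p1 p2.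
rewrite (polys_mulw (fsubset_refl _) (msuppD_le p1 p2)).
rewrite (polys_mulw (fsubset_refl _) (fsubsetUl _ (msupp p2))).
rewrite (polys_mulw (fsubset_refl _) (fsubsetUr (msupp p1) _)).
rewrite -big_split /=; apply/eq_bigr=> k1 _.
rewrite -big_split /=; apply/eq_bigr=> k2 _.
by rewrite mcoeffD mulrDr monalgUD.
Qed.

Lemma polys_mul0 : left_zero 0 polys_mul.
Proof. by move=> p; rewrite /polys_mul msupp0 big_seq_fset0. Qed.

Lemma polys_mulr0 : right_zero 0 polys_mul.
Proof. by move=> p; rewrite /polys_mul big1 // => k _; rewrite msupp0 big_seq_fset0. Qed.

Lemma polys_mulUU c1 c2 m1 m2 :
  polys_mul << c1 *g m1 >> << c2 *g m2 >> = << c1 * c2 *g (mmul m1 m2) >>.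
Proof. by rewrite (polys_mulw msuppU_le msuppU_le) !big_seq_fset1 !mcoeffUU. Qed.

Lemma polys_ind (P : polys n R -> Prop) :
  (forall p q, P p -> P q -> P (p + q)) -> P 0 ->
  (forall c m, P << c *g m >>) -> forall p, P p.
Proof. by move=> PD P0 PU p; rewrite [p]monalgE; apply: big_ind. Qed.

Lemma polys_mulA : associative polys_mul.
Proof.
pose gen p := exists c m, p = << c *g m >>.
apply: (@associative_on_generators (polys n R) polys_mul gen _
  polys_mulDl polys_mulDr polys_mul0 polys_mulr0).
- move=> P PD P0 PU; apply: polys_ind => // c m.
  by apply: PU; exists c, m.
- move=> _ _ _ [c1 [m1 ->]] [c2 [m2 ->]] [c3 [m3 ->]].
  have eR := congr1 (polys_mul << c1 *g m1 >>) (polys_mulUU c2 c3 m2 m3).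
  have eL := congr1 (polys_mul^~ << c3 *g m3 >>) (polys_mulUU c1 c2 m1 m2).
  apply: (etrans eR); apply: (etrans (polys_mulUU _ _ _ _)).
  rewrite mulrA mulmA; apply: esym.
  exact: (etrans eL (polys_mulUU _ _ _ _)).
Qed.

Lemma polys_mul1 : left_id polys1 polys_mul.
Proof.
elim/polys_ind => [p1 p2 IH1 IH2||c m]; first by rewrite polys_mulDr IH1 IH2.
  by rewrite polys_mulr0.
by rewrite polys_mulUU mul1r mul1m.
Qed.

Lemma polys_mulr1 : right_id polys1 polys_mul.
Proof.
elim/polys_ind => [p1 p2 IH1 IH2||c m]; first by rewrite polys_mulDl IH1 IH2.
  by rewrite polys_mul0.
by rewrite polys_mulUU mulr1 mulm1.
Qed.

HB.instance Definition _ := GRing.Zmodule_isPzRing.Build (polys n R)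
  polys_mulA polys_mul1 polys_mulr1 polys_mulDl polys_mulDr.

End PolysRing.

(* The value at x of the polynomial obtained from p by applying u to its
   coefficients. *)
Definition polys_eval (n : nat) (R S : pzRingType) (u : R -> S)
    (x : 'I_n -> S) (p : polys n R) : S :=
  \sum_(m <- msupp p) u p@_m * \prod_(i < n) x i ^+ m i.

(* The substitution s_i = t_i in R[s_1, ..., s_n], for t in Z^n. *)
Definition specialize (n : nat) (R : pzRingType) (t : 'I_n -> int)
    (p : polys n R) : R :=
  polys_eval id (fun i => (t i)%:~R) p.

Definition is_ideal (A : comPzRingType) (I : set A) : Prop :=
  [/\ I 0, forall x y, I x -> I y -> I (x + y) & forall a x, I x -> I (a * x)].

Definition noetherian_ring (A : comPzRingType) : Prop :=
  forall I : set A, is_ideal I ->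
    exists n (g : 'I_n -> A),
      I = [set x | exists c : 'I_n -> A, x = \sum_(i < n) c i * g i].

Definition finitely_generated_algebra (K A : comPzRingType)
    (j : {rmorphism K -> A}) : Prop :=
  exists n (x : 'I_n -> A), forall a : A, exists p : polys n K,
    a = polys_eval j x p.

Definition is_unit_elt (A : comPzRingType) (a : A) : Prop :=
  exists b, a * b = 1.

Definition is_local_maximal_ideal (A : comPzRingType) (m : set A) : Prop :=
  [/\ is_ideal m, ~ m 1 & forall a, ~ m a -> is_unit_elt a].

Fixpoint ideal_pow (A : comPzRingType) (I : set A) (n : nat) : set A :=
  if n is n'.+1 then
    [set x | exists k (a b : 'I_k -> A),
      [/\ forall i, I (a i), forall i, ideal_pow I n' (b i)
        & x = \sum_(i < k) a i * b i]]
  else setT.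

(* Bijectivity of A -> lim_n A / I^n: a compatible family of classes is given by
   representatives x_n with x_(n+1) = x_n mod I^n. *)
Definition adically_complete (A : comPzRingType) (I : set A) : Prop :=
  forall x : nat -> A, (forall n, ideal_pow I n (x n.+1 - x n)) ->
    exists! a : A, forall n, ideal_pow I n (a - x n).

Definition complete_local_ring (A : comPzRingType) : Prop :=
  exists2 m : set A, is_local_maximal_ideal m & adically_complete m.

Section DiffOp.
Context (T : comPzRingType).

Implicit Types (f g : T -> T) (r x : T).

Definition is_additive f : Prop := forall x y, f (x + y) = f x + f y.

Definition commutator f r : T -> T := fun x => f (r * x) - r * f x.

Fixpoint diffop_order (m : nat) f : Prop :=
  if m is m'.+1 then
    is_additive f /\ forall r, diffop_order m' (commutator f r)
  else exists a, f =1 *%R a.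

Lemma diffop_order_ext m f g : f =1 g -> diffop_order m f -> diffop_order m g.
Proof. by move=> /funext ->. Qed.

Lemma diffop_order_additive m f : diffop_order m f -> is_additive f.
Proof. by case: m => [[a fE] x y|m [] //]; rewrite !fE mulrDr. Qed.

Lemma diffop_order0 m : diffop_order m (fun=> 0).
Proof.
elim: m => [|m IH]; first by exists 0 => x; rewrite mul0r.
split=> [x y|r]; first by rewrite addr0.
by apply: diffop_order_ext IH => x; rewrite /commutator mulr0 subr0.
Qed.

Lemma diffop_orderS m f : diffop_order m f -> diffop_order m.+1 f.
Proof.
elim: m f => [|m IH] f df; have fD := diffop_order_additive df.
  case: df => a fE; split=> // r.
  by exists 0 => x; rewrite /commutator !fE mulrCA subrr mul0r.
by split=> // r; case: df => _ /(_ r); apply: IH.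
Qed.

Lemma diffop_order_leq m n f : (m <= n)%N -> diffop_order m f -> diffop_order n f.
Proof.
by move=> /subnK <- df; elim: (n - m)%N => [|k IH] //; apply: diffop_orderS.
Qed.

Lemma diffop_orderD m f g : diffop_order m f -> diffop_order m g ->
  diffop_order m (fun x => f x + g x).
Proof.
elim: m f g => [|m IH] f g.
  by move=> [a fE] [b gE]; exists (a + b) => x; rewrite fE gE mulrDl.
move=> [fD df] [gD dg]; split=> [x y|r]; first by rewrite fD gD addrACA.
apply: diffop_order_ext (IH _ _ (df r) (dg r)) => x.
by rewrite /commutator mulrDr opprD addrACA.
Qed.

Lemma diffop_orderN m f : diffop_order m f -> diffop_order m (fun x => - f x).
Proof.
elim: m f => [|m IH] f.
  by move=> [a fE]; exists (- a) => x; rewrite fE mulNr.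
move=> [fD df]; split=> [x y|r]; first by rewrite fD opprD.
apply: diffop_order_ext (IH _ (df r)) => x.
by rewrite /commutator mulrN opprB opprK addrC.
Qed.

Lemma diffop_order_comp m n f g : diffop_order m f -> diffop_order n g ->
  diffop_order (m + n) (f \o g).
Proof.
have [k] := ubnP (m + n); elim: k m n f g => // k IH m n f g lt_mn df dg.
have fD := diffop_order_additive df; have gD := diffop_order_additive dg.
have f0 : f 0 = 0 by apply: (addrI (f 0)); rewrite -fD !addr0.
have fB x y : f (x - y) = f x - f y.
  by apply: (addIr (f y)); rewrite -fD !subrK.
case E : (m + n)%N => [|q].
  have /andP[/eqP m0 /eqP n0] : (m == 0) && (n == 0) by rewrite -addn_eq0 E.
  move: df dg; rewrite m0 n0 => -[a fE] [b gE].
  by exists (a * b) => x; rewrite /= fE gE mulrA.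
split=> [x y|r]; first by rewrite /= gD fD.
have comE x : commutator (f \o g) r x =
    (f \o commutator g r) x + (commutator f r \o g) x.
  by rewrite /commutator /= fB addrA subrK.
apply: (@diffop_order_ext _ _ _ (fsym comE)).
apply: diffop_orderD.
- case: n dg lt_mn E => [[b gE] _ _|n [_ dg] lt_mn E].
    apply: diffop_order_ext (diffop_order0 q) => x.
    by rewrite /= /commutator !gE mulrCA subrr f0.
  by move: E lt_mn; rewrite addnS => -[<-] lt_mn; exact: IH lt_mn df (dg r).
- case: m df lt_mn E => [[a fE] _ _|m [_ df] lt_mn E].
    apply: diffop_order_ext (diffop_order0 q) => x.
    by rewrite /= /commutator !fE mulrCA subrr.
  by move: E lt_mn; rewrite addSn => -[<-] lt_mn; exact: IH lt_mn (df r) dg.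
Qed.

Lemma diffop_order_id : diffop_order 0 id.
Proof. by exists 1 => x; rewrite mul1r. Qed.

End DiffOp.

(* The ring D_{T|K}, with composition as product. *)
Section DiffOpRing.
Context (K T : comPzRingType) (j : {rmorphism K -> T}).

Definition is_diffop (f : T -> T) : Prop :=
  (exists m, diffop_order m f) /\ forall c x, f (j c * x) = j c * f x.

Record diffop := Diffop { diffop_fun :> T -> T; diffopP : is_diffop diffop_fun }.

HB.instance Definition _ := gen_eqMixin diffop.
HB.instance Definition _ := gen_choiceMixin diffop.

Implicit Types d e : diffop.

Lemma diffop_ext d e : d =1 e -> d = e.
Proof.
case: d e => [f fP] [g gP] /= /funext fg.
by move: fP gP; rewrite fg => fP gP; rewrite (Prop_irrelevance fP gP).
Qed.

Fact diffop_zero_subproof : is_diffop (fun=> 0).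
Proof. by split=> [|c x]; [exists 0%N; exact: diffop_order0 | rewrite mulr0]. Qed.

Fact diffop_opp_subproof d : is_diffop (fun x => - d x).
Proof.
case: d => f [[m df] fK]; split=> [|c x] /=; last by rewrite fK mulrN.
by exists m; apply: diffop_orderN.
Qed.

Fact diffop_add_subproof d e : is_diffop (fun x => d x + e x).
Proof.
case: d e => f [[m df] fK] [g [[n dg] gK]].
split=> [|c x] /=; last by rewrite fK gK mulrDr.
exists (maxn m n); apply: diffop_orderD.
  by apply: diffop_order_leq df; rewrite leq_maxl.
by apply: diffop_order_leq dg; rewrite leq_maxr.
Qed.

Fact diffop_one_subproof : is_diffop id.
Proof. by split=> //; exists 0%N; exact: diffop_order_id. Qed.

Fact diffop_mul_subproof d e : is_diffop (d \o e).
Proof.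
case: d e => f [[m df] fK] [g [[n dg] gK]].
split=> [|c x] /=; last by rewrite gK fK.
by exists (m + n)%N; apply: diffop_order_comp.
Qed.

Definition diffop_zero := Diffop diffop_zero_subproof.
Definition diffop_opp d := Diffop (diffop_opp_subproof d).
Definition diffop_add d e := Diffop (diffop_add_subproof d e).
Definition diffop_one := Diffop diffop_one_subproof.
Definition diffop_mul d e := Diffop (diffop_mul_subproof d e).

Lemma diffop_addA : associative diffop_add.
Proof. by move=> d e f; apply: diffop_ext => x /=; rewrite addrA. Qed.

Lemma diffop_addC : commutative diffop_add.
Proof. by move=> d e; apply: diffop_ext => x /=; rewrite addrC. Qed.

Lemma diffop_add0 : left_id diffop_zero diffop_add.
Proof. by move=> d; apply: diffop_ext => x /=; rewrite add0r. Qed.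

Lemma diffop_addN : left_inverse diffop_zero diffop_opp diffop_add.
Proof. by move=> d; apply: diffop_ext => x /=; rewrite addNr. Qed.

HB.instance Definition _ := GRing.isZmodule.Build diffop
  diffop_addA diffop_addC diffop_add0 diffop_addN.

Lemma diffop_mulA : associative diffop_mul.
Proof. by move=> d e f; apply: diffop_ext. Qed.

Lemma diffop_mul1 : left_id diffop_one diffop_mul.
Proof. by move=> d; apply: diffop_ext. Qed.

Lemma diffop_mulr1 : right_id diffop_one diffop_mul.
Proof. by move=> d; apply: diffop_ext. Qed.

Lemma diffop_mulDl : left_distributive diffop_mul +%R.
Proof. by move=> d e f; apply: diffop_ext. Qed.

Lemma diffop_mulDr : right_distributive diffop_mul +%R.
Proof.
move=> d e f; apply: diffop_ext => x /=.
by case: (diffopP d) => -[m /diffop_order_additive ->].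
Qed.

HB.instance Definition _ := GRing.Zmodule_isPzRing.Build diffop
  diffop_mulA diffop_mul1 diffop_mulr1 diffop_mulDl diffop_mulDr.

End DiffOpRing.

(* i : A -> B exhibits B as the localization A_g. *)
Definition is_localization_away (A B : comPzRingType) (i : {rmorphism A -> B})
    (g : A) : Prop :=
  [/\ is_unit_elt (i g),
      forall b, exists a n, b * i g ^+ n = i a
    & forall a, i a = 0 -> exists n, g ^+ n * a = 0].

(* The extension of d in D_{A|K} to D_{B|K}, for B a localization A_g: it exists
   and is unique in that case, so the default value 0 is irrelevant. *)
Definition diffop_extension (K A B : comPzRingType) (j : {rmorphism K -> A})
    (i : {rmorphism A -> B}) (d : diffop j) : diffop (i \o j) :=
  xget 0 [set d' : diffop (i \o j) | forall a, d' (i a) = i (d a)].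

(* Integer powers of a unit x; the default value 0 of the inverse is used only
   when x is not a unit. *)
Definition unit_zpow (B : comPzRingType) (x : B) (k : int) : B :=
  match k with
  | Posz n => x ^+ n
  | Negz n => xget 0 [set y | x * y = 1] ^+ n.+1
  end.

(* M^A[f^s]: the free B[s]-module of rank one, for B = A_{f_1...f_l}; h stands
   for h f_1^s_1 ... f_l^s_l. *)
Definition Mfs (l : nat) (B : comPzRingType) := (polys l B)^o.

HB.instance Definition _ l B := GRing.Lmodule.on (Mfs l B).

Definition exp_specialize (l : nat) (A B : comPzRingType)
    (i : {rmorphism A -> B}) (f : 'I_l -> A) (t : 'I_l -> int)
    (v : Mfs l B) : B :=
  specialize t v * \prod_(k < l) unit_zpow (i (f k)) (t k).

Definition is_lmodule_action (R : pzRingType) (V : zmodType)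
    (act : R -> V -> V) : Prop :=
  [/\ forall v, act 1 v = v,
      forall a b v, act (a * b) v = act a (act b v),
      forall a b v, act (a + b) v = act a v + act b v
    & forall a v w, act a (v + w) = act a v + act a w].

(* Main.v *)
(* Write [f^t] for the product of the powers [f_k ^ t_k].  Over the localization
   [B], conjugation of a differential operator by the unit [f_k] differs from the
   identity by an operator lowering the order, so [f^-t D f^t] is given by finite
   binomial series and is polynomial in [t]; characteristic zero makes the
   binomial coefficients available.  Hence for all [delta] and [v] some element
   of [B[s] f^s] specializes to [delta(t) v(t)] for every integer vector [t].  It
   is unique because a polynomial over a Q-algebra is determined by its values at
   integer vectors, and this uniqueness also yields the module axioms. *)
From HB Require Import structures.
Require Import Defs.
From mathcomp Require Import all_boot all_algebra ring.
From mathcomp Require Import boolp classical_sets.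
From mathcomp Require Import finmap monalg.

Set Implicit Arguments.
Unset Strict Implicit.
Unset Printing Implicit Defensive.

Import GRing.Theory.
Local Open Scope ring_scope.

(** * Composing differential operators with multiplications *)

Section Order.
Context (T : comPzRingType).
Implicit Types (F G : T -> T) (r x y : T).

Lemma is_additive0 F : is_additive F -> F 0 = 0.
Proof. by move=> FD; apply: (addrI (F 0)); rewrite -FD !addr0. Qed.

Lemma diffop_order_mull m F r :
  diffop_order m F -> diffop_order m (fun x => r * F x).
Proof.
move=> dF; have dr : diffop_order 0 ( *%R r) by exists r.
exact: (diffop_order_comp dr dF).
Qed.

Lemma diffop_order_mulr m F r :
  diffop_order m F -> diffop_order m (fun x => F (r * x)).
Proof.
move=> dF; have dr : diffop_order 0 ( *%R r) by exists r.
by have := diffop_order_comp dF dr; rewrite addn0.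
Qed.

End Order.

(** * Extending differential operators to a localization *)

Section Localization.
Context (A B : comPzRingType) (i : {rmorphism A -> B}) (g : A).
Hypothesis locB : is_localization_away i g.

Implicit Types (D : B -> B) (d : A -> A).

Lemma loc_inv : exists v, i g * v = 1.
Proof. by case: locB. Qed.

Lemma loc_frac b : exists n a, b * i g ^+ n = i a.
Proof. by case: locB => _ /(_ b) [a [n ?]] _; exists n, a. Qed.

Lemma loc_eq a a' : i a = i a' -> exists n, g ^+ n * a = g ^+ n * a'.
Proof.
move=> aa'; case: locB => _ _ /(_ (a - a')) [|n].
  by rewrite rmorphB aa' subrr.
by rewrite mulrBr => /subr0_eq; exists n.
Qed.

(** By induction on the order, commutators with the image of [A] vanish, so [D] is linear over that
    image; a denominator of [x] is then cleared by the unit [i g]. *)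
Lemma diffop_order_loc0 m D :
  diffop_order m D -> (forall a, D (i a) = 0) -> D =1 fun=> 0.
Proof.
elim: m D => [|m IH] D.
  move=> [c DE] D0 x; have := D0 1.
  by rewrite !DE rmorph1 mulr1 => ->; rewrite mul0r.
move=> [_ dD] D0 x.
have Dg r y : D (i r * y) = i r * D y.
  apply/subr0_eq; apply: (IH _ (dD (i r))) => a.
  by rewrite /commutator -rmorphM !D0 mulr0 subr0.
have [n [a xE]] := loc_frac x; have [v gv] := loc_inv.
have : i (g ^+ n) * D x = 0 by rewrite -Dg rmorphXn mulrC xE D0.
move/(congr1 ( *%R (v ^+ n))).
by rewrite rmorphXn mulrA -exprMn [v * _]mulrC gv expr1n mul1r mulr0.
Qed.

Lemma diffop_order_loc_eq m n D D' : diffop_order m D -> diffop_order n D' ->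
  (forall a, D (i a) = D' (i a)) -> D =1 D'.
Proof.
move=> dD dD' DD' x; apply/subr0_eq.
apply: (@diffop_order_loc0 (maxn m n) (fun x => D x - D' x)) => [|a].
  apply: diffop_orderD; first by apply: diffop_order_leq dD; rewrite leq_maxl.
  apply: diffop_orderN; by apply: diffop_order_leq dD'; rewrite leq_maxr.
by rewrite DD' subrr.
Qed.

(* The commutator of [D] with an element [r] of [B] is determined by those with
   a numerator and a denominator of [r], by the Leibniz rule. *)
Lemma diffop_order_locS m D : is_additive D ->
  (forall a, diffop_order m (commutator D (i a))) -> diffop_order m.+1 D.
Proof.
move=> DD dD; split=> // r.
have [n [a rE]] := loc_frac r; have [v gv] := loc_inv.
have gvn : i (g ^+ n) * v ^+ n = 1 by rewrite rmorphXn -exprMn gv expr1n.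
have dE : diffop_order m (fun x => commutator D (i a) (v ^+ n * x)
    + - (r * commutator D (i (g ^+ n)) (v ^+ n * x))).
  apply: diffop_orderD; first exact: diffop_order_mulr.
  by apply/diffop_orderN/diffop_order_mull/diffop_order_mulr.
apply: diffop_order_ext dE => x; rewrite /commutator.
have -> : i (g ^+ n) * (v ^+ n * x) = x by rewrite mulrA gvn mul1r.
have -> : i a * (v ^+ n * x) = r * x.
  by rewrite -rE -rmorphXn -mulrA (mulrA _ (v ^+ n)) gvn mul1r.
by rewrite -rE -rmorphXn; ring.
Qed.

(** Induction on the order: the commutators of [d] extend to maps [C r], from which the extension of
    [d] is rebuilt. *)
Lemma diffop_order_extend m d : diffop_order m d ->
  exists2 D, diffop_order m D & forall a, D (i a) = i (d a).
Proof.
elim: m d => [|m IH] d.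
  move=> [c dE]; exists ( *%R (i c)); first by exists (i c).
  by move=> a; rewrite dE rmorphM.
move=> [dD dd].
have /choice [C CP] r : exists D, diffop_order m D /\
    forall a, D (i a) = i (commutator d r a).
  by have [D] := IH _ (dd r); exists D.
have dC r : diffop_order m (C r) by case: (CP r).
have CE r a : C r (i a) = i (d (r * a)) - i r * i (d a).
  by case: (CP r) => _ ->; rewrite /commutator rmorphB !rmorphM.
have CD r := diffop_order_additive (dC r).
(* The Leibniz rule for commutators holds on the image of [A] and spreads to [B] by uniqueness of
   extensions. *)
have CM r s x : C (r * s) x = C r (i s * x) + i r * C s x.
  move: x; apply: (@diffop_order_loc_eq m m) => // [|a].
    apply: (diffop_orderD (f := fun x => C r (i s * x))).
      exact: diffop_order_mulr.
    exact: diffop_order_mull.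
  by rewrite -rmorphM !CE rmorphM -[r * s * a]mulrA; ring.
have [v gv] := loc_inv.
have gvn n : i (g ^+ n) * v ^+ n = 1 by rewrite rmorphXn -exprMn gv expr1n.
(* [v ^+ n * (i (d a) - C (g ^+ n) x)] is forced to be the value at
   [x = a / g ^+ n], as [C r] must be the commutator with [i r]. *)
pose E n a x := v ^+ n * (i (d a) - C (g ^+ n) x).
have Eshift k n a x : x * i (g ^+ n) = i a ->
    E n a x = E (k + n)%N (g ^+ k * a) x.
  move=> xE; rewrite /E !exprD CM [i (g ^+ n) * x]mulrC xE CE.
  transitivity (i (g ^+ k) * v ^+ k * (v ^+ n * (i (d a) - C (g ^+ n) x))).
    by rewrite gvn mul1r.
  by ring.
(* Numerators over a common denominator agree after multiplication by some [g ^+ k], which [Eshift]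
   allows. *)
have Ewd n a n' a' x : x * i (g ^+ n) = i a -> x * i (g ^+ n') = i a' ->
    E n a x = E n' a' x.
  move=> xE xE'; have /loc_eq [k ak] : i (g ^+ n' * a) = i (g ^+ n * a').
    by rewrite !rmorphM -xE -xE'; ring.
  rewrite (Eshift (k + n')%N _ _ _ xE) (Eshift (k + n)%N _ _ _ xE').
  by rewrite !exprD -!mulrA ak addnAC.
have /choice [D DP] x : exists y, forall n a, x * i (g ^+ n) = i a -> y = E n a x.
  have [n [a]] := loc_frac x; rewrite -rmorphXn => xE.
  by exists (E n a x) => n' a'; apply: Ewd.
have C1 x : C 1 x = 0.
  apply: (addrI (C 1 x)).
  by rewrite addr0 -[RHS](congr1 (C^~ x) (mulr1 1)) CM rmorph1 !mul1r.
have DE a : D (i a) = i (d a).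
  by rewrite (DP _ 0%N a) ?expr0 ?rmorph1 ?mulr1 // /E expr0 C1 subr0 mul1r.
have DD : is_additive D.
  move=> x y; have [n [a]] := loc_frac x; have [n' [a']] := loc_frac y.
  rewrite -!rmorphXn => yE xE.
  have xE' : x * i (g ^+ (n' + n)) = i (g ^+ n' * a).
    by rewrite exprD !rmorphM -xE; ring.
  have yE' : y * i (g ^+ (n' + n)) = i (g ^+ n * a').
    by rewrite exprD !rmorphM -yE; ring.
  have xyE : (x + y) * i (g ^+ (n' + n)) = i (g ^+ n' * a + g ^+ n * a').
    by rewrite mulrDl xE' yE' rmorphD.
  by rewrite (DP _ _ _ xyE) (DP _ _ _ xE') (DP _ _ _ yE') /E dD rmorphD CD; ring.
exists D => //; apply: diffop_order_locS => // r.
apply: diffop_order_ext (dC r) => x.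
have [n [a]] := loc_frac x; rewrite -rmorphXn => xE.
have rxE : i r * x * i (g ^+ n) = i (r * a) by rewrite -mulrA xE rmorphM.
rewrite /commutator (DP _ _ _ rxE) (DP _ _ _ xE) /E.
(* [C (r * g ^+ n) x] is expanded by the Leibniz rule in both orders of the factors. *)
have swap : C r (i a) + i r * C (g ^+ n) x
    = C (g ^+ n) (i r * x) + i (g ^+ n) * C r x.
  by rewrite -CM [_ * r]mulrC CM [i (g ^+ n) * x]mulrC xE.
have {}swap : i (g ^+ n) * C r x
    = i (d (r * a)) - i r * i (d a) + i r * C (g ^+ n) x - C (g ^+ n) (i r * x).
  by rewrite -CE swap; ring.
transitivity (v ^+ n * (i (g ^+ n) * C r x)).
  by rewrite mulrA [v ^+ n * _]mulrC gvn mul1r.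
by rewrite swap; ring.
Qed.

End Localization.

(** * Substituting integers into polynomials *)

Section Specialize.
Context (n : nat) (R : pzRingType).
Implicit Types (t : 'I_n -> int) (p q : polys n R) (m : 'X_{1..n}) (c : R).

(** Kept in [int], so that it acts on any coefficient ring by [*~] and is central there. *)
Definition monomial_value t m : int := \prod_(k < n) t k ^+ m k.

Lemma monomial_valueM t m1 m2 :
  monomial_value t (mmul m1 m2) = monomial_value t m1 * monomial_value t m2.
Proof.
by rewrite /monomial_value -big_split; apply: eq_bigr => k _; rewrite cmM exprD.
Qed.

Lemma monomial_value1 t : monomial_value t mone = 1.
Proof. by rewrite /monomial_value big1 // => k _; rewrite cm1. Qed.

Lemma specializeE t p :
  specialize t p = \sum_(m <- msupp p) p@_m *~ monomial_value t m.
Proof.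
rewrite /specialize /polys_eval; apply: eq_bigr => m _.
rewrite -mulrzr /monomial_value rmorph_prod.
by congr (_ * _); apply: eq_bigr => k _; rewrite rmorphXn.
Qed.

Lemma specializew t p (X : {fset 'X_{1..n}}) : (msupp p `<=` X)%fset ->
  specialize t p = \sum_(m <- X) p@_m *~ monomial_value t m.
Proof.
move=> pX; rewrite specializeE; apply: big_fset_incl => // m _ /mcoeff_outdom ->.
by rewrite mul0rz.
Qed.

Lemma specializeD t p q : specialize t (p + q) = specialize t p + specialize t q.
Proof.
rewrite (specializew _ (msuppD_le p q)).
rewrite (specializew _ (fsubsetUl _ (msupp q))).
rewrite (specializew _ (fsubsetUr (msupp p) _)) -big_split /=.
by apply: eq_bigr => m _; rewrite mcoeffD mulrzDl.
Qed.

Lemma specialize0 t : specialize t (0 : polys n R) = 0.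
Proof. by rewrite specializeE msupp0 big_seq_fset0. Qed.

Lemma specializeU t c m :
  specialize t (<< c *g m >> : polys n R) = c *~ monomial_value t m.
Proof. by rewrite (specializew _ msuppU_le) big_seq_fset1 mcoeffUU. Qed.

Lemma specialize1 t : specialize t (1 : polys n R) = 1.
Proof. by rewrite specializeU monomial_value1. Qed.

Lemma specializeM t p q : specialize t (p * q) = specialize t p * specialize t q.
Proof.
elim/polys_ind: p => [p1 p2 IH1 IH2||c m].
- rewrite [in LHS](mulrDl p1 p2 q) [in RHS]specializeD mulrDl -IH1 -IH2.
  exact: specializeD.
- by rewrite [in LHS](mul0r q) specialize0 mul0r.
elim/polys_ind: q => [q1 q2 IH1 IH2||c' m'].
- rewrite [in LHS](mulrDr _ q1 q2) [X in _ = _ * X]specializeD [RHS]mulrDr.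
  exact: etrans (specializeD t _ _) (f_equal2 +%R IH1 IH2).
- by rewrite [_ * 0]polys_mulr0 specialize0 mulr0.
rewrite [X in specialize t X](polys_mulUU c c' m m') [LHS]specializeU.
rewrite [X in _ = X * _]specializeU [X in _ = _ * X]specializeU monomial_valueM.
by rewrite mulrzAl mulrzAr -!mulrzA mulrC.
Qed.

End Specialize.

(** * Polynomials determined by their values at integer vectors *)

Lemma infinitely_many_primes :
  exists2 P : nat -> nat, injective P & forall k, prime (P k).
Proof.
pose next m := s2val (prime_above m).
have lt_next m : (m < next m)%N by exact: (s2valP (prime_above m)).
have pr_next m : prime (next m) by exact: (s2valP' (prime_above m)).
exists (fun k => iter k next 2%N) => [|[|k]] //; last exact: pr_next.
apply/incn_inj/leq_mono; apply: homo_ltn => [y x z|k]; first exact: ltn_trans.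
exact: lt_next.
Qed.

(** At distinct primes, each exponent is a valuation of the value, by unique factorization. *)
Lemma monomial_value_separated (n : nat) :
  exists t : 'I_n -> int, injective (monomial_value t).
Proof.
have [P Pinj Pprime] := infinitely_many_primes.
exists (fun k => (P k)%:Z) => m m' mm'; apply/eqP/cmP => k.
have logE m1 : logn (P k) `|monomial_value (fun k : 'I_n => (P k)%:Z) m1|%N = m1 k.
  rewrite /monomial_value (bigD1 k) //= abszM abszX absz_nat.
  rewrite mulnC logn_Gauss ?pfactorK //.
  apply: (big_ind (fun x : int => coprime (P k) `|x|%N)) => [|x y cx cy|k' k'k].
  - by rewrite coprimen1.
  - by rewrite abszM coprimeMr cx.
  rewrite abszX absz_nat coprimeXr // prime_coprime // dvdn_prime2 //.
  by apply: contraNneq k'k => /Pinj/val_inj ->.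
by rewrite -logE mm' logE.
Qed.

Definition additive_torsion_free (V : zmodType) :=
  forall (x : V) (z : int), z != 0 -> x *~ z = 0 -> x = 0.

(* At a point separating the monomials and at all its powers, a polynomial
   [sum_m c_m s^m] takes the values [sum_m c_m mu_m^k] with distinct integers
   [mu_m], so that [sum_m c_m h(mu_m) = 0] for every integer polynomial [h]; the
   polynomial [h] vanishing at all [mu_m] but one isolates a coefficient. *)
Lemma specialize_eq0 (n : nat) (B : pzRingType) (p : polys n B) :
  additive_torsion_free B -> (forall t, specialize t p = 0) -> p = 0.
Proof.
move=> tfB p0; apply/malgP => m0; rewrite mcoeff0.
have [m0p|/mcoeff_outdom //] := boolP (m0 \in msupp p).
have [t tinj] := monomial_value_separated n.
pose mu := monomial_value t.
have muX k m : monomial_value (fun a => t a ^+ k) m = mu m ^+ k.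
  rewrite /mu /monomial_value -prodrXl; apply: eq_bigr => a _.
  by rewrite exprAC.
have vanish (h : {poly int}) : \sum_(m <- msupp p) p@_m *~ h.[mu m] = 0.
  transitivity (\sum_(k < size h) specialize (fun a => t a ^+ k) p *~ h`_k).
    under [RHS]eq_bigr => k _ do rewrite specializeE mulrz_suml.
    rewrite exchange_big /=; apply: eq_bigr => m _.
    rewrite horner_coef mulrz_sumr; apply: eq_bigr => k _.
    by rewrite -mulrzA muX mulrC.
  by rewrite big1 // => k _; rewrite p0 mul0rz.
pose h : {poly int} := \prod_(z <- [seq mu m | m <- msupp p & m != m0]) ('X - z%:P).
have hE m : root h (mu m) = (m != m0) && (m \in msupp p).
  by rewrite root_prod_XsubC mem_map // mem_filter.
(* [h.[mu m0]] is a nonzero integer, so torsion-freeness allows cancelling it from the coefficient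
   at [m0]. *)
apply: (tfB _ h.[mu m0]); first by rewrite -[_ == 0]/(root h _) hE eqxx.
rewrite -[RHS](vanish h) (big_fsetD1 m0) //= big1_seq ?addr0 // => m /=.
rewrite in_fsetD1 -hE => /rootP hm.
by rewrite hm mulr0z.
Qed.

(** * Units and their integer powers *)

Section IntegerPowers.
Context (B : comPzRingType) (u : B).
Hypothesis uU : is_unit_elt u.

(** Since [u] is a unit, the element chosen in [unit_zpow] is a true inverse. *)
Let uV : u * xget 0 [set y | u * y = 1] = 1.
Proof. by case: uU => y uy; exact: (xgetI 0 (P := [set y | u * y = 1]) uy). Qed.

Lemma unit_zpowD1 (n : int) : unit_zpow u (n + 1) = u * unit_zpow u n.
Proof.
case: n => [n|[|n]].
- by rewrite -PoszD addn1 /= exprS.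
- by rewrite NegzE addNr /= expr0 expr1 uV.
- have -> : Negz n.+1 + 1 = Negz n by rewrite !NegzE -addn1 PoszD opprD addrNK.
  by rewrite /= [in RHS]exprS mulrA uV mul1r.
Qed.

Lemma unit_zpow_unit (n : int) : is_unit_elt (unit_zpow u n).
Proof.
case: n => n /=.
  by exists (xget 0 [set y | u * y = 1] ^+ n); rewrite -exprMn uV expr1n.
by exists (u ^+ n.+1); rewrite -exprMn mulrC uV expr1n.
Qed.

End IntegerPowers.

Lemma is_unit_elt_prod (B : comPzRingType) (I : finType) (F : I -> B) :
  (forall k, is_unit_elt (F k)) -> is_unit_elt (\prod_k F k).
Proof.
move=> /choice [G FG]; exists (\prod_k G k).
by rewrite -big_split big1 //= => k _.
Qed.

Lemma is_unit_elt_prodE (B : comPzRingType) (I : finType) (F : I -> B) k :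
  is_unit_elt (\prod_k F k) -> is_unit_elt (F k).
Proof.
move=> [y]; rewrite (bigD1 k) //= -mulrA => Fy.
by exists (\prod_(k' | k' != k) F k' * y).
Qed.

Lemma is_unit_elt_mulI (B : comPzRingType) (x : B) :
  is_unit_elt x -> injective ( *%R x).
Proof.
by move=> [y xy] a b /(congr1 ( *%R y)); rewrite !mulrA [y * x]mulrC xy !mul1r.
Qed.

(** * Binomial coefficients with integer upper index *)

Section IntegerBinomial.
Context (K : fieldType).
Hypothesis K0 : [pchar K] =i pred0.

(** The coefficient n(n-1)...(n-k+1)/k! for [n] of any sign, with values in [K] so that division is
    available. *)
Fixpoint int_binomial (k : nat) (n : int) : K :=
  if k is k'.+1 then int_binomial k' n * (n - k'%:Z)%:~R / k'.+1%:R else 1.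

Lemma int_binomial0 k : int_binomial k.+1 0 = 0.
Proof.
elim: k => [|k IH]; first by rewrite /= subrr mulr0 mul0r.
by rewrite [LHS]/= -/(int_binomial k.+1 0) IH !mul0r.
Qed.

(** Pascal's rule, also for negative [n]: in the inductive step, multiplication by k+2 reduces it to
    (n-k) C(n,k) = (k+1) C(n,k+1). *)
Lemma int_binomialS k n :
  int_binomial k.+1 (n + 1) = int_binomial k.+1 n + int_binomial k n.
Proof.
have nz m : m.+1%:R != 0 :> K by rewrite (pcharf0P K).1.
elim: k => [|k IH]; first by rewrite /= !subr0 rmorphD /= !mul1r !divr1.
rewrite [LHS]/= -/(int_binomial k.+1 (n + 1)) IH.
rewrite [int_binomial k.+2 n]/= -/(int_binomial k.+1 n).
set b := int_binomial k.+1 n.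
have bE : int_binomial k n * (n - k%:Z)%:~R = b * k.+1%:R.
  by rewrite /b /= mulfVK.
apply: (mulIf (nz k.+1)); rewrite mulfVK ?nz // [RHS]mulrDl mulfVK ?nz //.
have -> : n + 1 - k.+1%:Z = n - k%:Z by rewrite -addn1 PoszD; ring.
rewrite mulrDl bE.
have -> : n - k%:Z = (n - k.+1%:Z) + 1 by rewrite -addn1 PoszD; ring.
by rewrite rmorphD /= -[k.+2]addn1 natrD; ring.
Qed.

End IntegerBinomial.

(** * Binomial series for conjugation by a unit *)

Section Taylor.
Context (K : fieldType) (B : comPzRingType) (iota : {rmorphism K -> B}).
Hypothesis K0 : [pchar K] =i pred0.
Implicit Types (D : B -> B) (u v x : B).

(** When [v] is the inverse of [u], this is u^-1 D u - D. *)
Definition conj_diff v u D : B -> B := fun x => v * commutator D u x.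

Lemma conj_diffE v u D x : u * v = 1 -> D (u * x) = u * (D x + conj_diff v u D x).
Proof. by move=> uv; rewrite mulrDr mulrA uv mul1r addrC subrK. Qed.

Lemma conj_diff_order v u m D :
  diffop_order m.+1 D -> diffop_order m (conj_diff v u D).
Proof. by move=> [_ /(_ u)]; exact: diffop_order_mull. Qed.

Lemma conj_diff_order0 v u D x : diffop_order 0 D -> conj_diff v u D x = 0.
Proof.
by move=> [c DE]; rewrite /conj_diff /commutator !DE mulrCA subrr mulr0.
Qed.

(** An operator of order 0 commutes with multiplications, so there [conj_diff] gives 0 and the bound
    stays valid for every [k]. *)
Lemma iter_conj_diff_order v u m D k :
  diffop_order m D -> diffop_order m (iter k (conj_diff v u) D).
Proof.
elim: k => [//|k IH] /IH /=; case: m {IH} => [d0|m dm].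
  exact: diffop_order_ext (fun x => esym (conj_diff_order0 v u x d0)) (diffop_order0 B 0).
exact/diffop_orderS/conj_diff_order.
Qed.

(* [D |-> u^-1 D u] is the identity plus the locally nilpotent [conj_diff], hence
   its integer powers are given by the binomial series. *)
Lemma diffop_order_zpow m D u v (n : int) x : u * v = 1 -> diffop_order m D ->
  D (unit_zpow u n * x) = unit_zpow u n *
    \sum_(k < m.+1) iota (int_binomial K k n) * iter k (conj_diff v u) D x.
Proof.
move=> uv; have uU : is_unit_elt u by exists v.
elim: m D n x => [|m IH] D n x dD.
  rewrite big_ord1 /= rmorph1 mul1r.
  by case: dD => [c DE]; rewrite !DE mulrCA.
pose S D' k n := \sum_(j < k) iota (int_binomial K j n) * iter j (conj_diff v u) D' x.
rewrite -/(S D m.+2 n).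
(* Pascal's rule splits every term after the first; the second halves form the series of
   [conj_diff v u D]. *)
have SD k : S D m.+2 (k + 1) = S D m.+2 k + S (conj_diff v u D) m.+1 k.
  rewrite /S big_ord_recl [in RHS]big_ord_recl -addrA; congr (_ + _).
  rewrite -big_split; apply: eq_bigr => j _.
  by rewrite lift0 (int_binomialS K0) rmorphD mulrDl -iterSr.
(* The defect of the formula is multiplied by [u] when the exponent grows by 1; this uses the
   induction hypothesis for [conj_diff v u D], of lower order. *)
have step k : D (unit_zpow u (k + 1) * x) - unit_zpow u (k + 1) * S D m.+2 (k + 1)
    = u * (D (unit_zpow u k * x) - unit_zpow u k * S D m.+2 k).
  rewrite (unit_zpowD1 uU) -mulrA (conj_diffE _ _ uv) (IH _ _ _ (conj_diff_order v u dD)).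
  by rewrite SD -/(S _ _ _); ring.
apply/subr0_eq; elim/int_ind: n => [|n IHn|n IHn].
- rewrite /S big_ord_recl big1 => [|j _].
    by rewrite /= rmorph1 !mul1r addr0 subrr.
  by rewrite lift0 int_binomial0 rmorph0 mul0r.
- by rewrite -addn1 PoszD step IHn mulr0.
(* Downwards, the unit [u] is cancelled from the recurrence for the defect. *)
- apply: (is_unit_elt_mulI uU); rewrite mulr0 -step.
  have -> : - n.+1%:Z + 1 = - n%:Z by rewrite -addn1 PoszD; ring.
  exact: IHn.
Qed.

End Taylor.

(** * Polynomial dependence on the exponents *)

Section PolynomialDependence.
Context (K : fieldType) (B : comPzRingType) (iota : {rmorphism K -> B}) (l : nat).
Hypothesis K0 : [pchar K] =i pred0.
Implicit Types (t : 'I_l -> int) (D : B -> B).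

(** A nonzero integer is invertible in [K], hence acts invertibly on [B]. *)
Lemma algebra_torsion_free : additive_torsion_free B.
Proof.
move=> x z z0 xz.
have zK : z%:~R != 0 :> K.
  case: z z0 {xz} => [[//|n] _|n _].
    by rewrite -pmulrn (pcharf0P K).1.
  by rewrite NegzE mulrNz oppr_eq0 -pmulrn (pcharf0P K).1.
have : iota (z%:~R^-1) * (x *~ z) = x.
  by rewrite -[x *~ z]mulrzr mulrCA -(rmorph_int iota) -rmorphM mulVf // rmorph1 mulr1.
by rewrite xz mulr0 => <-.
Qed.

Definition is_polynomial_function (F : ('I_l -> int) -> B) :=
  exists w : polys l B, forall t, specialize t w = F t.

Lemma polynomial_function_cst b : is_polynomial_function (fun=> b).
Proof.
by exists << b *g mone >> => t; rewrite specializeU monomial_value1.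
Qed.

Lemma polynomial_function_coord (a : 'I_l) :
  is_polynomial_function (fun t => (t a)%:~R).
Proof.
exists << 1 *g ucm a >> => t.
rewrite specializeU /monomial_value (bigD1 a) //= cmU eqxx big1 ?mulr1 // => b ba.
by rewrite cmU eq_sym (negbTE ba).
Qed.

Lemma polynomial_functionD F G :
  is_polynomial_function F -> is_polynomial_function G ->
  is_polynomial_function (fun t => F t + G t).
Proof.
by move=> [w wE] [w' wE']; exists (w + w') => t; rewrite -wE -wE' specializeD.
Qed.

Lemma polynomial_functionM F G :
  is_polynomial_function F -> is_polynomial_function G ->
  is_polynomial_function (fun t => F t * G t).
Proof.
by move=> [w wE] [w' wE']; exists (w * w') => t; rewrite -wE -wE' specializeM.
Qed.

Lemma polynomial_function_sum (I : Type) (r : seq I) F :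
  (forall k, is_polynomial_function (F k)) ->
  is_polynomial_function (fun t => \sum_(k <- r) F k t).
Proof.
move=> pF; elim: r => [|k r [w wE]].
  by exists 0 => t; rewrite big_nil specialize0.
have [w' wE'] := polynomial_functionD (pF k) (ex_intro _ w wE).
by exists w' => t; rewrite big_cons wE'.
Qed.

Lemma int_binomial_polynomial k (a : 'I_l) :
  is_polynomial_function (fun t => iota (int_binomial K k (t a))).
Proof.
elim: k => [|k IH].
  by have [w wE] := polynomial_function_cst 1; exists w => t; rewrite wE rmorph1.
have [w wE] := polynomial_functionM (polynomial_functionM IH
  (polynomial_functionD (polynomial_function_coord a)
    (polynomial_function_cst (- k%:R)))) (polynomial_function_cst (iota k.+1%:R^-1)).
by exists w => t; rewrite wE /= !rmorphM rmorph_int mulrzBr -pmulrn.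
Qed.

(** The binomial series in each exponent has length bounded by the order, and its coefficients are
    polynomial in that exponent. *)
Lemma diffop_order_polynomial (u : 'I_l -> B) (uU : forall k, is_unit_elt (u k))
    m D (dD : diffop_order m D) (b : B) :
  exists2 F, is_polynomial_function F & forall t,
    D (\prod_(k < l) unit_zpow (u k) (t k) * b)
    = \prod_(k < l) unit_zpow (u k) (t k) * F t.
Proof.
have [v uv] := choice uU.
(* Coordinates are peeled off a list one at a time; [D] is generalized because each removal replaces
   it by iterates of [conj_diff]. *)
elim: (index_enum 'I_l) m D dD => [|a r IH] m D dD.
  exists (fun=> D b) => [|t]; first exact: polynomial_function_cst.
  by rewrite !big_nil !mul1r.
have /choice [F FP] k : exists F, is_polynomial_function F /\ forall t,
    iter k (conj_diff (v a) (u a)) D (\prod_(k <- r) unit_zpow (u k) (t k) * b)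
    = \prod_(k <- r) unit_zpow (u k) (t k) * F t.
  by have [F] := IH m _ (iter_conj_diff_order (v a) (u a) k dD); exists F.
exists (fun t => \sum_(k < m.+1) iota (int_binomial K k (t a)) * F k t) => [|t].
  apply: polynomial_function_sum => k; apply: polynomial_functionM.
    exact: int_binomial_polynomial.
  by case: (FP k).
rewrite !big_cons -mulrA (diffop_order_zpow iota K0 _ _ (uv a) dD) -mulrA.
congr (_ * _); rewrite mulr_sumr; apply: eq_bigr => k _.
by case: (FP k) => _ ->; rewrite mulrCA.
Qed.

End PolynomialDependence.

(** * Compatibility of the extension with the ring operations *)

Section Extension.
Context (K A B : comPzRingType) (j : {rmorphism K -> A}).
Context (i : {rmorphism A -> B}) (g : A).
Hypothesis locB : is_localization_away i g.
Implicit Types (d e : diffop j) (D : diffop (i \o j)).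

Lemma diffop_loc_eq D D' : (forall a, D (i a) = D' (i a)) -> D = D'.
Proof.
case: (diffopP D) (diffopP D') => [[m dD] _] [[n dD'] _] DD'.
exact/diffop_ext/(diffop_order_loc_eq locB dD dD').
Qed.

(** An extension exists, so [xget] returns one of the searched set. *)
Lemma diffop_extensionE d a : diffop_extension i d (i a) = i (d a).
Proof.
move: a; apply: (@xgetPex _ 0 [set D : diffop (i \o j) | forall a, D (i a) = i (d a)]).
have [[m dd] dK] := diffopP d.
have [D dD DE] := diffop_order_extend locB dd.
(* Both sides are differential operators in [x] agreeing on the image of [A], so [K]-linearity
   passes to [B]. *)
have DK c x : D ((i \o j) c * x) = (i \o j) c * D x.
  have dl := diffop_order_mulr (i (j c)) dD.
  have dr := diffop_order_mull (i (j c)) dD.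
  apply: (diffop_order_loc_eq locB dl dr) => a.
  by rewrite /= -rmorphM !DE dK rmorphM.
by exists (Diffop (conj (ex_intro _ m dD) DK)).
Qed.

(** Reduces identities between extensions to a check on the image of [A]. *)
Lemma diffop_extension_unique d D :
  (forall a, D (i a) = i (d a)) -> diffop_extension i d = D.
Proof. by move=> DE; apply: diffop_loc_eq => a; rewrite DE diffop_extensionE. Qed.

Lemma diffop_extension1 : diffop_extension i (1 : diffop j) = 1.
Proof. exact: diffop_extension_unique. Qed.

Lemma diffop_extensionD d e :
  diffop_extension i (d + e) = diffop_extension i d + diffop_extension i e.
Proof.
by apply: diffop_extension_unique => a; rewrite /= !diffop_extensionE rmorphD.
Qed.

Lemma diffop_extensionM d e :
  diffop_extension i (d * e) = diffop_extension i d * diffop_extension i e.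
Proof. by apply: diffop_extension_unique => a; rewrite /= !diffop_extensionE. Qed.

Lemma diffop_extension0 : diffop_extension i (0 : diffop j) = 0.
Proof. by apply: diffop_extension_unique => a; rewrite /= rmorph0. Qed.

End Extension.

(** * Additivity of operators and integer multiples *)

Section DiffopApp.
Context (K T : comPzRingType) (j : {rmorphism K -> T}) (d : diffop j).

Lemma diffopD x y : d (x + y) = d x + d y.
Proof. by case: (diffopP d) => [[m /diffop_order_additive]]. Qed.

Lemma diffop0 : d 0 = 0.
Proof. by case: (diffopP d) => [[m /diffop_order_additive/is_additive0]]. Qed.

End DiffopApp.

Lemma morphD_mulrz (U V : zmodType) (h : U -> V) :
  {morph h : x y / x + y} -> forall x z, h (x *~ z) = h x *~ z.
Proof.
move=> hD x z.
have h0 : h 0 = 0 by apply: (addrI (h 0)); rewrite -hD !addr0.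
have hB : {morph h : x y / x - y}.
  by move=> y y'; apply: (addIr (h y')); rewrite -hD !subrK.
pose H := GRing.isZmodMorphism.Build U V h hB.
pose hA : {additive U -> V} := HB.pack h H.
exact: (raddfMz hA).
Qed.

(** * The action on the free module *)

Section Action.
Context (K : fieldType) (K0 : [pchar K] =i pred0).
Context (A : comPzRingType) (j : {rmorphism K -> A}) (l : nat) (f : 'I_l -> A).
Context (B : comPzRingType) (i : {rmorphism A -> B}).
Hypothesis locB : is_localization_away i (\prod_(k < l) f k).
Implicit Types (delta : polys l (diffop j)) (v w : Mfs l B) (t : 'I_l -> int).

(** Each [i (f k)] divides the image of the product, which is a unit of [B]. *)
Let fU k : is_unit_elt (i (f k)).
Proof.
apply: (is_unit_elt_prodE (F := fun k => i (f k))).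
by rewrite -rmorph_prod; case: locB.
Qed.

(** Once the unit f^t is cancelled, [v - w] specializes to 0 at every integer vector. *)
Lemma exp_specialize_inj v w :
  (forall t, exp_specialize i f t v = exp_specialize i f t w) -> v = w.
Proof.
move=> vw; apply/subr0_eq; apply: (specialize_eq0 (algebra_torsion_free (i \o j) K0)) => t.
have UU : is_unit_elt (\prod_(k < l) unit_zpow (i (f k)) (t k)).
  by apply: is_unit_elt_prod => k; apply: unit_zpow_unit.
apply: (is_unit_elt_mulI UU); rewrite mulr0 mulrC.
have tN : specialize t (- w : polys l B) = - specialize t w.
  by apply/eqP; rewrite -addr_eq0 -specializeD addNr specialize0.
rewrite (specializeD t v (- w)) tN mulrBl; apply/eqP; rewrite subr_eq0; apply/eqP.
exact: vw.
Qed.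

Lemma exp_specializeD t v w :
  exp_specialize i f t (v + w) = exp_specialize i f t v + exp_specialize i f t w.
Proof. by rewrite /exp_specialize (specializeD t v w) mulrDl. Qed.

(** Absorbs the integer factors that monomials in s contribute under substitution. *)
Lemma exp_specialize_mul_monomial w m : exists w', forall t,
  exp_specialize i f t w' = exp_specialize i f t w *~ monomial_value t m.
Proof.
exists (w * << 1 *g m >>) => t; rewrite /exp_specialize.
by rewrite [specialize t (w * _)]specializeM (specializeU t 1 m) mulrzr mulrzAl.
Qed.

(** Both sides are additive in [delta] and in [v], which reduces the claim to d s^m acting on b
    s^m'. *)
Lemma exp_specialize_action_exists delta v : exists w, forall t,
  exp_specialize i f t w =
  diffop_extension i (specialize t delta) (exp_specialize i f t v).
Proof.
elim/polys_ind: delta => [d1 d2 [w1 IH1] [w2 IH2]||d m].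
- exists (w1 + w2) => t.
  by rewrite exp_specializeD IH1 IH2 (specializeD t d1 d2) (diffop_extensionD locB).
- exists 0 => t; rewrite specialize0 (diffop_extension0 j locB).
  by rewrite /exp_specialize specialize0 mul0r.
have dE t x : diffop_extension i (specialize t (<< d *g m >> : polys l (diffop j))) x
    = diffop_extension i d x *~ monomial_value t m.
  rewrite specializeU.
  rewrite (morphD_mulrz (h := fun e : diffop j => diffop_extension i e x)) //.
  by move=> e e'; rewrite (diffop_extensionD locB).
have : exists w, forall t,
    exp_specialize i f t w = diffop_extension i d (exp_specialize i f t v).
  elim/polys_ind: v => [v1 v2 [w1 IH1] [w2 IH2]||b m'].
  - exists (w1 + w2) => t.
    by rewrite exp_specializeD IH1 IH2 -diffopD -exp_specializeD.
  - by exists 0 => t; rewrite /exp_specialize specialize0 mul0r diffop0.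
  (* As [d] and [b] do not involve [t], the value d(f^t b) is f^t times a polynomial function of
     [t]. *)
  have [[q dq] _] := diffopP (diffop_extension i d).
  have [F [w wF] FE] := diffop_order_polynomial (i \o j) K0 fU dq b.
  have [w' w'E] := exp_specialize_mul_monomial w m'.
  exists w' => t; rewrite w'E /exp_specialize wF specializeU mulrzAl.
  by rewrite (morphD_mulrz (diffopD _)) [F t * _]mulrC -FE mulrC.
move=> [w wE]; have [w' w'E] := exp_specialize_mul_monomial w m.
by exists w' => t; rewrite w'E dE wE.
Qed.

End Action.

Theorem theorem2p12 (K : fieldType) (K0 : [pchar K] =i pred0)
    (A : comPzRingType) (j : {rmorphism K -> A})
    (noethA : noetherian_ring A)
    (fgA : finitely_generated_algebra j \/ complete_local_ring A)
    (l : nat) (f : 'I_l -> A)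
    (B : comPzRingType) (i : {rmorphism A -> B})
    (locB : is_localization_away i (\prod_(k < l) f k)) :
  exists! act : polys l (diffop j) -> Mfs l B -> Mfs l B,
    is_lmodule_action act /\
    forall (v : Mfs l B) (delta : polys l (diffop j)) (t : 'I_l -> int),
      exp_specialize i f t (act delta v) =
      diffop_extension i (specialize t delta) (exp_specialize i f t v).
Proof.
have inj := exp_specialize_inj K0 j locB.
(* The chosen values are forced, since by [inj] the specializations determine them. *)
have /choice [act actP] (dv : polys l (diffop j) * Mfs l B) :=
  exp_specialize_action_exists K0 locB dv.1 dv.2.
exists (fun delta v => act (delta, v)); split=> [|act' [_ act'P]]; last first.
  apply/funext => delta; apply/funext => v; apply: inj => t.
  by rewrite actP act'P.
split=> [|v delta t]; last exact: (actP (delta, v)).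
(* Each module axiom is tested under all specializations, where it becomes a property of operators
   on [B]. *)
split=> [v|a b v|a b v|a v w]; apply: inj => t.
- by rewrite actP /= specialize1 (diffop_extension1 j locB).
- by rewrite !actP /= specializeM (diffop_extensionM locB).
- by rewrite exp_specializeD !actP /= (specializeD t a b) (diffop_extensionD locB).
- by rewrite exp_specializeD !actP /= exp_specializeD diffopD.
Qed.
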